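(* Let $p$ be an odd prime, write $p-1=2^sq$ with $q$ odd, and set $r=\frac{p-1}{2}$. Then: (1) There are exactly $2^{2^{s-1}}$ Tonelli--Shanks polynomials over $\mathbb{F}_p$. (2) The degree of every Tonelli--Shanks polynomial $f_{TS}$ has the form $$\deg(f_{TS})=\frac{(2^s-1)p+1}{2^{s+1}}-nq=r-\frac{q-1}{2}-nq$$ for some integer $n\ge 0$. Moreover, if $f_{TS}(x)=\sum_i c_ix^i$, then $c_i=0$ unless $i=r-\frac{q-1}{2}-nq$ for some integer $n\ge 0$. (3) The maximum degree $r-\frac{q-1}{2}$ (the case $n=0$) is attained by at least one Tonelli--Shanks polynomial, and in fact by the majority (more than half) of them.
   Context: Let $S\subset\mathbb{F}_p^\times$ be the set of nonzero squares, i.e. the group $\mu_r$ of $r$-th roots of unity. Fix a primitive $2^{s-1}$-st root of unity $\zeta\in\mathbb{F}_p$ and a square root $\zeta^{1/2}\in\mathbb{F}_p$ of $\zeta$ (a $2^s$-th root of unity); write $\zeta^{-k/2}=(\zeta^{1/2})^{-k}$. For $0\le k\le 2^{s-1}-1$ put $f_k(x)=\zeta^{-k/2}x^{\frac{q+1}{2}}$; it satisfies $f_k(a)^2=a$ for all $a\in S$ with $a^q=\zeta^k$. A Tonelli--Shanks (TS) polynomial is any polynomial in $\mathbb{F}_p[x]$ of the form $$f(x)=\sum_{k=0}^{2^{s-1}-1}h_k\,f_k(x)\prod_{\substack{0\le i\le 2^{s-1}-1\\ i\ne k}}\frac{x^q-\zeta^i}{\zeta^k-\zeta^i},\qquad h_k\in\{\pm1\}.$$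 No reduction modulo $x^r-1$ is performed. Every such polynomial satisfies $f(a)^2=a$ for all $a\in S$. *)

(* Defs.v *)
From HB Require Import structures.
From mathcomp Require Import all_boot all_order all_algebra finmap.

Set Implicit Arguments.
Unset Strict Implicit.
Unset Printing Implicit Defensive.

Import Order.TTheory GRing.Theory Num.Theory.
Local Open Scope fset_scope.
Local Open Scope ring_scope.

Section TonelliShanks.

(* Throughout, p - 1 = 2 ^ s * q with q odd, zeta is a primitive
   2 ^ (s - 1)-st root of unity and zeta_half a square root of zeta; these
   assumptions are made in the theorem, not here. *)
Variables (p s q : nat) (zeta zeta_half : 'F_p).

Definition TS_branch (k : nat) : {poly 'F_p} :=
  zeta_half ^- k *: 'X^((q + 1) %/ 2).

Definition TS_poly (h : {ffun 'I_(2 ^ (s - 1)) -> 'F_p}) : {poly 'F_p} :=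
  \sum_(k < 2 ^ (s - 1))
    h k *: (TS_branch k *
      \prod_(i < 2 ^ (s - 1) | i != k)
        ((zeta ^+ k - zeta ^+ i)^-1 *: ('X^q - (zeta ^+ i)%:P))).

(* The set of polynomials, not of sign vectors: equal polynomials arising from
   different h are counted once. *)
Definition TS_polys : {fset {poly 'F_p}} :=
  [fset TS_poly h | h in ffun_on (pred2 (1 : 'F_p) (-1))].

Lemma TS_polysP (f : {poly 'F_p}) :
  f \in TS_polys <->
  exists2 h : {ffun 'I_(2 ^ (s - 1)) -> 'F_p},
    (forall k, h k = 1 \/ h k = -1) & f = TS_poly h.
Proof.
split=> [/imfsetP[h /ffun_onP hP ->]|[h hP ->]].
  by exists h => // k; case/pred2P: (hP k); [left | right].
apply/imfsetP; exists h => //=; apply/ffun_onP => k.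
by apply/pred2P; exact: hP.
Qed.

End TonelliShanks.

(* Only meaningful as a degree for f != 0. *)
Definition deg (R : nzRingType) (f : {poly R}) : nat := (size f).-1.

(* Main.v *)
(* With [n = 2 ^ (s - 1)] and [w] the square root of [zeta], a TS polynomial is
   [x^((q+1)/2) g(x^q)], where [g] of degree < [n] interpolates [h_k w^-k] at
   [zeta^k].  Hence [g] determines [h], and the exponents lie in
   [(q+1)/2 + q j], [j < n].  Since [prod_(i != k) (zeta^k - zeta^i)] is
   [n zeta^-k], the coefficient of [x^(n-1)] in [g] is [n^-1 sum_k h_k w^k].
   The map flipping [h_0] sends sign vectors at which this vanishes to ones at
   which it does not, and it is not onto the latter. *)
Require Import Defs.
From HB Require Import structures.
From mathcomp Require Import all_boot all_order all_algebra finmap.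
From mathcomp Require Import zify ring.

Set Implicit Arguments.
Unset Strict Implicit.
Unset Printing Implicit Defensive.

Import Order.TTheory GRing.Theory Num.Theory.
Local Open Scope fset_scope.
Local Open Scope ring_scope.

(** * Vanishing signed sums in a field of characteristic other than 2 *)

Section SignedSums.

Variables (F : fieldType) (I : finType) (b : I -> F).
Implicit Type e : {ffun I -> bool}.

Definition signed_sum e : F := \sum_i (-1) ^+ e i * b i.

Definition flip (j : I) e : {ffun I -> bool} := [ffun i => e i (+) (i == j)].

Lemma flipK j : involutive (flip j).
Proof. by move=> e; apply/ffunP => i; rewrite !ffunE addbK. Qed.

Lemma flip_neq i j e : i != j -> flip j e i = e i.
Proof. by rewrite ffunE => /negPf ->; rewrite addbF. Qed.

Lemma signed_sum_flip j e :
  signed_sum (flip j e) = signed_sum e - (-1) ^+ e j * b j *+ 2.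
Proof.
rewrite /signed_sum (bigD1 j) //= [in RHS](bigD1 j) //=.
rewrite ffunE eqxx addbT signrN.
rewrite (eq_bigr (fun i => (-1) ^+ e i * b i)) => [|i ij].
  by ring.
by rewrite flip_neq.
Qed.

Hypothesis two_neq0 : 2%:R != 0 :> F.
Hypothesis b_neq0 : forall i, b i != 0.

(* Flipping the sign at [i0] maps zeros of [signed_sum] to non-zeros.  If
   this were onto, [signed_sum e - (-1) ^+ e i0 * b i0] would always be
   [+- b i0], which flipping any other sign refutes. *)
Lemma signed_sum_zero_minority (i0 : I) :
    (forall j, j != i0 -> b j ^+ 2 != b i0 ^+ 2) ->
  (2 * #|[set e | signed_sum e == 0%R]| < 2 ^ #|I|)%N.
Proof.
move=> b_sqr; set Z := [set e | _].
have cardZ : (#|Z| + #|~: Z| = 2 ^ #|I|)%N.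
  by rewrite cardsC card_ffun card_bool.
rewrite ltnNge -cardZ mul2n -addnn leq_add2l; apply/negP => leZ.
have neq0D x : x != 0 -> x *+ 2 != 0 :> F.
  by move=> x0; rewrite -mulr_natr mulf_neq0.
have sgn_neq0 j e : (-1) ^+ e j * b j != 0.
  by rewrite mulf_neq0 ?signr_eq0.
(* The flip is injective and sends [Z] into its complement, which by [leZ] is no larger; hence it is
   onto. *)
have flipZ : flip i0 @: Z = ~: Z.
  apply/eqP; rewrite eqEcard card_imset ?leZ ?andbT //;
    last exact: inv_inj (flipK i0).
  apply/subsetP => _ /imsetP[e + ->]; rewrite !inE => /eqP Se.
  by rewrite signed_sum_flip Se sub0r oppr_eq0 neq0D.
(* [T e] is the part of the sum away from [i0]. If the sum vanishes, [T e] is minus the [i0] term;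
   otherwise [e] is the flip of a zero, and [T e] is the [i0] term itself. *)
pose T e := signed_sum e - (-1) ^+ e i0 * b i0.
have T_sqr e : T e ^+ 2 = b i0 ^+ 2.
  have [Se|Se] := boolP (e \in Z).
    move: Se; rewrite inE /T => /eqP ->.
    by rewrite sub0r sqrrN exprMn sqrr_sign mul1r.
  have : e \in ~: Z by rewrite inE.
  rewrite -flipZ => /imsetP[e' + def_e].
  have -> : e' = flip i0 e by rewrite def_e flipK.
  rewrite inE signed_sum_flip subr_eq0 /T => /eqP ->.
  by rewrite mulr2n addrK exprMn sqrr_sign mul1r.
(* If [i0] is the only index, [T] is an empty sum, so [T_sqr] would force [b i0 = 0]. *)
have [j ji0|no_j] := pickP (fun j => j != i0); last first.
  move: (T_sqr [ffun=> false]) (b_neq0 i0).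
  rewrite /T /signed_sum (bigD1 i0) //=.
  rewrite addrAC subrr add0r big_pred0 // expr0n /= => /esym/eqP.
  by rewrite sqrf_eq0 => ->.
pose e : {ffun I -> bool} := [ffun=> false]; pose x := (-1) ^+ e j * b j.
have Tflip : T (flip j e) = T e - x *+ 2.
  by rewrite /T signed_sum_flip flip_neq 1?eq_sym // addrAC.
(* [T e] and [T e - 2x] have the same square, and the difference of the squares is [4x(x - T e)]. So
   [x = T e], and squaring gives the excluded [b j ^+ 2 = b i0 ^+ 2]. *)
have : x *+ 2 * (x - T e) *+ 2 = 0.
  by rewrite -(subrr (b i0 ^+ 2)) -{1}(T_sqr (flip j e)) Tflip -(T_sqr e); ring.
move/eqP; apply/negP/neq0D; rewrite mulf_neq0 ?neq0D ?sgn_neq0 // subr_eq0.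
apply: contra (b_sqr j ji0) => /eqP xT.
by rewrite -(T_sqr e) -xT exprMn sqrr_sign mul1r.
Qed.

End SignedSums.

(** * Lagrange interpolation at the powers of a primitive root of unity *)

Section Interpolation.

Variables (F : fieldType) (n : nat) (z : F).
Hypothesis z_prim : n.-primitive_root z.

Definition punctured_prod (k : 'I_n) : {poly F} :=
  \prod_(i < n | i != k) ('X - (z ^+ i)%:P).

Lemma punctured_prodP (k : 'I_n) :
  ('X - (z ^+ k)%:P) * punctured_prod k = 'X^n - 1.
Proof. by rewrite -(factor_Xn_sub_1 z_prim) big_mkord [RHS](bigD1 k). Qed.

Lemma size_punctured_prod k : size (punctured_prod k) = n.
Proof.
rewrite /punctured_prod -big_filter size_prod_XsubC -cardE.
have := cardC1 k; rewrite card_ord /= => ->.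
by rewrite prednK // (prim_order_gt0 z_prim).
Qed.

Lemma lead_punctured_prod k : (punctured_prod k)`_n.-1 = 1.
Proof.
by have /monicP := monic_prod_XsubC (index_enum 'I_n) (fun i => i != k)
     (fun i : 'I_n => z ^+ i); rewrite /lead_coef size_punctured_prod.
Qed.

(* The value at [z ^+ k] is the derivative there of ['X^n - 1]. *)
Lemma horner_punctured_prod (k : 'I_n) :
  (punctured_prod k).[z ^+ k] = n%:R / z ^+ k.
Proof.
have zk0 : z ^+ k != 0.
  by rewrite expf_neq0 // (prim_root_eq0 z_prim) -lt0n (prim_order_gt0 z_prim).
have /(congr1 (fun p => p^`().[z ^+ k])) := punctured_prodP k.
rewrite derivM derivXsubC mul1r !derivB derivXn derivC subr0 !hornerE subrr.
rewrite mul0r addr0 => ->; apply: (mulIf zk0); rewrite divfK //.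
rewrite hornerMn hornerXn mulrnAl -exprSr prednK ?(prim_order_gt0 z_prim) //.
by rewrite -exprM mulnC exprM (prim_expr_order z_prim) expr1n.
Qed.

Lemma horner_punctured_prod0 (j k : 'I_n) :
  j != k -> (punctured_prod k).[z ^+ j] = 0.
Proof.
move=> jk; rewrite /punctured_prod (bigD1 j) //=.
by rewrite hornerM hornerXsubC subrr mul0r.
Qed.

(** When [w ^+ 2 = z], this is the Lagrange interpolant of the values [h k * w ^- k] at [z ^+ k]:
    dividing [w ^- k] by the node value [n / z ^+ k] leaves [w ^+ k / n]. *)
Definition TS_inner (w : F) (h : 'I_n -> F) : {poly F} :=
  \sum_k (h k * w ^+ k / n%:R) *: punctured_prod k.

Lemma size_TS_inner w h : (size (TS_inner w h) <= n)%N.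
Proof.
apply: leq_trans (size_sum _ _ _) _; apply/bigmax_leqP => k _.
by apply: leq_trans (size_scale_leq _ _) _; rewrite size_punctured_prod.
Qed.

Lemma lead_TS_inner w h : (TS_inner w h)`_n.-1 = (\sum_k h k * w ^+ k) / n%:R.
Proof.
rewrite coef_sum mulr_suml; apply: eq_bigr => k _.
by rewrite coefZ lead_punctured_prod mulr1.
Qed.

Lemma horner_TS_inner w h (k : 'I_n) :
  (TS_inner w h).[z ^+ k] = h k * w ^+ k / z ^+ k.
Proof.
rewrite horner_sum (bigD1 k) //= big1 => [|j jk].
  rewrite addr0 hornerZ horner_punctured_prod mulrA divfK //.
  exact: prim_root_natf_neq0 z_prim.
by rewrite hornerZ horner_punctured_prod0 ?mulr0 // eq_sym.
Qed.

End Interpolation.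

(** * TS polynomials as [TS_inner] at ['X^q], times ['X^m] *)

Section Factorization.

Variables (p s q : nat) (z w : 'F_p).
Hypothesis q_gt0 : (0 < q)%N.
Hypothesis z_prim : (2 ^ (s - 1)).-primitive_root z.
Hypothesis w_sqr : w ^+ 2 = z.

Let N := (2 ^ (s - 1))%N.
Let m := ((q + 1) %/ 2)%N.

Lemma TS_root_neq0 : w != 0.
Proof.
by rewrite -sqrf_eq0 w_sqr (prim_root_eq0 z_prim) -lt0n (prim_order_gt0 z_prim).
Qed.

(** Each product of numerators is [punctured_prod k] composed with ['X^q], and its denominators
    multiply to the value of [punctured_prod k] at [z ^+ k]. *)
Lemma TS_polyE (h : {ffun 'I_N -> 'F_p}) :
  TS_poly q z w h = (TS_inner z w h \Po 'X^q) * 'X^m.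
Proof.
rewrite /TS_inner linear_sum mulr_suml; apply: eq_bigr => k _ /=.
rewrite scaler_prod -scalerAl -scalerAr !scalerA.
rewrite linearZ -scalerAl [X in _ = _ *: X]mulrC; congr (_ *: (_ * _)).
  rewrite prodfV; have := horner_punctured_prod z_prim k.
  rewrite /punctured_prod horner_prod.
  under eq_bigr => i _ do rewrite hornerXsubC.
  move=> ->; rewrite invfM invrK -w_sqr -exprM.
  have wk0 : w ^+ k != 0 by rewrite expf_neq0 // TS_root_neq0.
  have n0 : N%:R != 0 :> 'F_p := prim_root_natf_neq0 z_prim.
  by rewrite mul2n -addnn exprD; field; rewrite wk0 n0.
rewrite /punctured_prod rmorph_prod; apply: eq_bigr => i _.
by rewrite rmorphB /= comp_polyX comp_polyC.
Qed.

Lemma coef_TS_poly (h : {ffun 'I_N -> 'F_p}) i :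
  (TS_poly q z w h)`_i =
    if (m <= i)%N && (q %| i - m)%N then (TS_inner z w h)`_((i - m) %/ q)
    else 0.
Proof. by rewrite TS_polyE coefMXn coef_comp_poly_Xn // ltnNge; case: leqP. Qed.

Lemma TS_inner_neq0 (h : {ffun 'I_N -> 'F_p}) (k : 'I_N) :
  h k != 0 -> TS_inner z w h != 0.
Proof.
move=> hk; apply: contraTneq hk => g0; have := horner_TS_inner z_prim w h k.
rewrite g0 horner0 => /esym/eqP.
rewrite -w_sqr -exprM !mulf_eq0 invr_eq0 !expf_eq0.
rewrite (negPf TS_root_neq0) !andbF !orbF.
by move=> ->.
Qed.

(** The coefficients at [i * q + m] recover the interpolant, whose values at the nodes recover
    [h]. *)
Lemma TS_poly_inj (h1 h2 : {ffun 'I_N -> 'F_p}) :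
  TS_poly q z w h1 = TS_poly q z w h2 -> h1 = h2.
Proof.
move=> eq_f; have eq_g : TS_inner z w h1 = TS_inner z w h2.
  apply/polyP => i; have := congr1 (fun f : {poly _} => f`_(i * q + m)) eq_f.
  by rewrite !coef_TS_poly leq_addl addnK dvdn_mull // mulnK.
apply/ffunP => k; have := congr1 (fun g => g.[z ^+ k]) eq_g.
rewrite !(horner_TS_inner z_prim) -w_sqr -!mulrA -exprM; apply: mulIf.
by rewrite mulf_neq0 ?invr_neq0 ?expf_neq0 ?TS_root_neq0.
Qed.

Lemma deg_TS_poly (h : {ffun 'I_N -> 'F_p}) :
  TS_inner z w h != 0 ->
  TS_poly q z w h != 0 /\
  deg (TS_poly q z w h) = (m + q * (size (TS_inner z w h)).-1)%N.
Proof.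
move=> g0; have sc := size_comp_poly (TS_inner z w h) ('X^q).
have c0 : TS_inner z w h \Po 'X^q != 0.
  apply: contra g0 => /eqP c0; apply/eqP/polyP => i.
  have := congr1 (fun f : {poly _} => f`_(i * q)) c0.
  by rewrite coef_comp_poly_Xn // dvdn_mull // mulnK // !coef0.
rewrite TS_polyE mulf_neq0 // -?size_poly_eq0 ?size_polyXn //; split=> //.
rewrite /deg size_mulXn //; move: sc; rewrite size_polyXn /= mulnC => <-.
by move: c0; rewrite -size_poly_gt0; case: (size _) => // k _; rewrite addnS.
Qed.

(** * Counting TS polynomials through Boolean sign vectors *)

Definition sign_vector (e : {ffun 'I_N -> bool}) : {ffun 'I_N -> 'F_p} :=
  [ffun k => (-1) ^+ e k].

Lemma TS_inner_sign_neq0 e : TS_inner z w (sign_vector e) != 0.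
Proof.
have N0 := prim_order_gt0 z_prim.
by apply: (@TS_inner_neq0 _ (Ordinal N0)); rewrite ffunE signr_eq0.
Qed.

Lemma TS_polys_signs f :
  reflect (exists e, f = TS_poly q z w (sign_vector e))
    (f \in TS_polys s q z w).
Proof.
apply: (iffP idP) => [/TS_polysP[h h_sign ->]|[e ->]].
  exists [ffun k => h k == -1]; congr (TS_poly _ _ _ _); apply/ffunP => k.
  rewrite !ffunE; have [-> //|hk] := eqVneq (h k) (-1).
  by case: (h_sign k) hk => -> // /eqP.
apply/TS_polysP; exists (sign_vector e) => // k.
by rewrite ffunE; case: (e k); [right | left].
Qed.

Hypothesis two_neq0 : 2%:R != 0 :> 'F_p.

Lemma sign_vector_inj : injective sign_vector.
Proof.
move=> e1 e2 /ffunP eq_e; apply/ffunP => k; have := eq_e k; rewrite !ffunE.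
have n1 : -1 != 1 :> 'F_p by rewrite eq_sym -addr_eq0.
by case: (e1 k) (e2 k) => [] [] // /eqP;
  rewrite expr0 expr1 1?[1 == _]eq_sym (negPf n1).
Qed.

Lemma TS_poly_sign_inj : injective (fun e => TS_poly q z w (sign_vector e)).
Proof. by move=> e1 e2 /TS_poly_inj /sign_vector_inj. Qed.

(** Distinct sign vectors give distinct polynomials, so counts of polynomials become counts in a
    finite type. *)
Lemma card_TS_polys_filter (P : pred {poly 'F_p}) :
  #|` [fset f in TS_polys s q z w | P f]| =
    #|[set e | P (TS_poly q z w (sign_vector e))]|.
Proof.
have -> : [fset f in TS_polys s q z w | P f] =
    [fset TS_poly q z w (sign_vector e)
      | e in [set e | P (TS_poly q z w (sign_vector e))]].
  apply/fsetP => f; rewrite !inE; apply/andP/imfsetP => /=.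
    by case=> /TS_polys_signs[e ->] Pe; exists e; rewrite ?inE.
  by case=> e; rewrite inE => Pe ->; split=> //; apply/TS_polys_signs; exists e.
by rewrite card_imfset ?cardE //; exact: TS_poly_sign_inj.
Qed.

Lemma card_TS_polys : #|` TS_polys s q z w| = (2 ^ N)%N.
Proof.
have -> : TS_polys s q z w = [fset f in TS_polys s q z w | predT f].
  by apply/fsetP => f; rewrite !inE andbT.
rewrite card_TS_polys_filter.
have <- : #|{ffun 'I_N -> bool}| = (2 ^ N)%N.
  by rewrite card_ffun card_bool card_ord.
by apply: eq_card => e; rewrite !inE.
Qed.

(** Up to the nonzero factor [N], the signed sum is the coefficient of index [N.-1] of the
    interpolant, the highest index its size allows. *)
Lemma deg_TS_poly_max e :
  (deg (TS_poly q z w (sign_vector e)) == m + q * N.-1)%N =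
    (signed_sum (fun k : 'I_N => w ^+ k) e != 0).
Proof.
have [_ ->] := deg_TS_poly (TS_inner_sign_neq0 e).
rewrite eqn_add2l eqn_pmul2l //.
have -> : signed_sum (fun k : 'I_N => w ^+ k) e =
    (TS_inner z w (sign_vector e))`_N.-1 * N%:R.
  rewrite (lead_TS_inner z_prim) divfK ?(prim_root_natf_neq0 z_prim) //.
  by apply: eq_bigr => k _; rewrite ffunE.
rewrite mulf_eq0 negb_or (prim_root_natf_neq0 z_prim) andbT.
apply/eqP/idP => [<-|].
  by rewrite -/(lead_coef _) lead_coef_eq0 TS_inner_sign_neq0.
(* If the size is not [N], it is smaller, and the coefficient of index [N.-1] is a default zero. *)
apply: contraNeq => neq; apply/eqP/nth_default.
rewrite -ltnS (prednK (prim_order_gt0 z_prim)) ltn_neqAle.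
rewrite (size_TS_inner z_prim) andbT.
by apply: contraNneq neq => ->.
Qed.

Lemma TS_polys_max_majority :
  (#|` TS_polys s q z w| <
     2 * #|` [fset f in TS_polys s q z w | (deg f == m + q * N.-1)%N]|)%N.
Proof.
rewrite card_TS_polys card_TS_polys_filter.
set A := [set e | _]; have N0 : (0 < N)%N := prim_order_gt0 z_prim.
have -> : A = ~: [set e | signed_sum (fun k : 'I_N => w ^+ k) e == 0].
  by apply/setP => e; rewrite !inE deg_TS_poly_max.
(* With [i0 = 0] the squares to separate are [z ^+ j] and 1, distinct for [0 < j < N] by
   primitivity. *)
have sqr_neq (j : 'I_N) : j != Ordinal N0 ->
    (w ^+ j) ^+ 2 != (w ^+ Ordinal N0) ^+ 2.
  rewrite -!exprM !(mulnC _ 2) !exprM w_sqr (eq_prim_root_expr z_prim) /= => j0.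
  by rewrite mod0n modn_small.
have := @signed_sum_zero_minority _ _ (fun k : 'I_N => w ^+ k) two_neq0
  (fun k => expf_neq0 k TS_root_neq0) _ sqr_neq.
rewrite card_ord.
have := cardsC [set e | signed_sum (fun k : 'I_N => w ^+ k) e == 0].
rewrite card_ffun card_bool card_ord => <-.
by rewrite mul2n -addnn ltn_add2l mul2n -addnn ltn_add2r.
Qed.

End Factorization.

(** * Passage from the exponents [m + q * d] to the rational formulas *)

Theorem theorem1p2 (p s q r : nat) (zeta zeta_half : 'F_p)
    (p_prime : prime p) (p_odd : odd p)
    (p_eq : (p - 1 = 2 ^ s * q)%N) (q_odd : odd q)
    (r_eq : (r = (p - 1) %/ 2)%N)
    (zeta_prim : (2 ^ (s - 1)).-primitive_root zeta)
    (zeta_half_sqr : zeta_half ^+ 2 = zeta) :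
  let TS := TS_polys s q zeta zeta_half in
  let dmax : rat := r%:R - (q%:R - 1) / 2%:R in
  [/\ #|` TS| = (2 ^ (2 ^ (s - 1)))%N,
      forall f : {poly 'F_p}, f \in TS ->
        [/\ f != 0,
            exists n : nat,
              (deg f)%:R =
                ((2%:R ^+ s - 1) * p%:R + 1) / 2%:R ^+ s.+1 - n%:R * q%:R
                :> rat
              /\
              ((2%:R ^+ s - 1) * p%:R + 1) / 2%:R ^+ s.+1 - n%:R * q%:R =
                dmax - n%:R * q%:R :> rat
          & forall i : nat,
              f`_i = 0 \/
              exists n : nat,
                i%:R = dmax - n%:R * q%:R :> rat]
    & [/\ forall f : {poly 'F_p}, f \in TS ->
            (deg f)%:R <= dmax,
          exists2 f : {poly 'F_p}, f \in TS &
            (deg f)%:R = dmax :> rat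
        & (#|` TS| <
           2 * #|` [fset f in TS |
                    (deg f)%:R%R == dmax]|)%N]].
Proof.
move=> TS dmax.
have q_gt0 : (0 < q)%N by case: (q) q_odd.
have two_neq0 : 2%:R != 0 :> 'F_p.
  rewrite -(dvdn_pcharf (pchar_Fp p_prime)); apply/negP.
  move=> /(dvdn_leq (isT : 0 < 2)%N).
  by have := prime_gt1 p_prime; case: (p) p_odd => [|[|[|]]].
set N := (2 ^ (s - 1))%N in zeta_prim *; set m := ((q + 1) %/ 2)%N.
have N_gt0 : (0 < N)%N := prim_order_gt0 zeta_prim.
(* [s = 0] would make [p - 1 = q] odd. Positivity ensures that [s - 1] is not truncated, so
   [2 ^ s = 2 * N]. *)
have s_gt0 : (0 < s)%N.
  case: (s) p_eq => // p_eq0; exfalso.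
  have : ~~ odd (p - 1) by have := prime_gt1 p_prime; move: p_odd; lia.
  by rewrite p_eq0 mul1n q_odd.
have two_s : (2 ^ s = 2 * N)%N by rewrite -expnS /N subn1 prednK.
have def_p : p = (2 * N * q + 1)%N.
  by rewrite -two_s -p_eq; have := prime_gt0 p_prime; lia.
have def_r : r = (N * q)%N by rewrite r_eq p_eq two_s -mulnA mulKn.
have def_q : q = (2 * m - 1)%N by rewrite /m; move: q_odd; lia.
have m_gt0 : (0 < m)%N by move: q_gt0; lia.
have dmaxE : dmax = (m + q * N.-1)%:R.
  rewrite /dmax def_r -(prednK N_gt0) /= def_q natrM natrD !natrM.
  rewrite natrB; last by lia.
  by rewrite natrM; field.
have formulaE : ((2%:R ^+ s - 1) * p%:R + 1) / 2%:R ^+ s.+1 = dmax.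
  rewrite exprS -natrX two_s /dmax def_r def_p.
  have N0 : N%:R != 0 :> rat by rewrite pnatr_eq0 -lt0n.
  by rewrite !(natrM, natrD); field.
(* The [n] of the statement counts down from the top index: [n = N.-1 - d]. *)
have below d : (d < N)%N ->
    exists n : nat, (m + q * d)%:R = dmax - n%:R * q%:R :> rat.
  move=> dN; exists (N.-1 - d)%N; rewrite dmaxE natrB; last by lia.
  by rewrite !natrD !natrM; ring.
have deg_natE f : ((deg f)%:R == dmax :> rat) = (deg f == m + q * N.-1)%N.
  by rewrite dmaxE eqr_nat.
have maj := TS_polys_max_majority q_gt0 zeta_prim zeta_half_sqr two_neq0.
have sizeN (h : 'I_N -> 'F_p) := size_TS_inner zeta_prim zeta_half h.
have pred_sizeN (h : 'I_N -> 'F_p) :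
    ((size (TS_inner zeta zeta_half h)).-1 < N)%N.
  by have := sizeN h; case: (size _) => [_|d] //=; exact: N_gt0.
split; first exact: card_TS_polys.
  move=> f /TS_polys_signs[e ->].
  have g0 := TS_inner_sign_neq0 zeta_prim zeta_half_sqr e.
  have [f0 deg_f] := deg_TS_poly q_gt0 zeta_prim zeta_half_sqr g0.
  split=> //.
    have [|n def_n] :=
      below (size (TS_inner zeta zeta_half (sign_vector p e))).-1.
      exact: pred_sizeN.
    by exists n; rewrite deg_f formulaE.
  move=> i; rewrite (coef_TS_poly q_gt0 zeta_prim zeta_half_sqr).
  case: ifP => [/andP[mi qi]|_]; last by left.
  (* Here [i = m + q * d]; for [d >= N] the coefficient lies beyond the size of the interpolant. *)
  have [lt_i|ge_i] := ltnP ((i - m) %/ q) N.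
    right; have [n def_n] := below _ lt_i; exists n.
    by rewrite -def_n mulnC divnK // subnKC.
  by left; apply: nth_default; apply: leq_trans (sizeN _) ge_i.
split.
- move=> f /TS_polys_signs[e ->]; rewrite dmaxE ler_nat.
  have g0 := TS_inner_sign_neq0 zeta_prim zeta_half_sqr e.
  have [_ ->] := deg_TS_poly q_gt0 zeta_prim zeta_half_sqr g0.
  rewrite leq_add2l leq_pmul2l //.
  by rewrite -ltnS (prednK N_gt0); apply: pred_sizeN.
(* The strict majority bound already rules out an empty set of maximal-degree polynomials. *)
- have : (0 < #|` [fset f in TS | (deg f == m + q * N.-1)%N]|)%N.
    by apply: contraLR maj; rewrite -!leqNgt leqn0 => /eqP->.
  rewrite cardfs_gt0 => /fset0Pn[f]; rewrite !inE => /andP[fTS deg_f].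
  by exists f => //; apply/eqP; rewrite deg_natE.
- suff -> : [fset f in TS | (deg f)%:R%R == dmax] =
            [fset f in TS | (deg f == m + q * N.-1)%N] by [].
  by apply/fsetP => f; rewrite !inE deg_natE.
Qed.
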